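(* Let $\mathcal{A}$ be a primal algebra and let $<$ be a linear order on its universe $A$. Then $\mathbf{OV}_{\mathit{fin}}(\mathcal{A},<)$ is a Ramsey age.
   Context: A primal algebra is a finite algebra with at least two elements in which every finitary operation on its universe is a term operation. For a linear order $<$ on $A$ and a positive integer $n$, the antilexicographic order $\sqsubset$ on $A^n$ is: $(x_1,\dots,x_n)\sqsubset(y_1,\dots,y_n)$ iff there is $s$ with $x_t=y_t$ for all $t>s$ and $x_s<y_s$. For a permutation $\pi$ of $\{1,\dots,n\}$, $\bar x\sqsubset_\pi\bar y$ iff $(x_{\pi(1)},\dots,x_{\pi(n)})\sqsubset(y_{\pi(1)},\dots,y_{\pi(n)})$; $\sqsubseteq_\pi$ is its reflexive version and $\mathcal{A}^n_{\sqsubseteq_\pi}$ is the power algebra $\mathcal{A}^n$ expanded by $\sqsubseteq_\pi$. $\mathbf{OV}_{\mathit{fin}}(\mathcal{A},<)$ is the category whose objects are all structures isomorphic to some $\mathcal{A}^n_{\sqsubseteq_\pi}$ ($n$ a positive integer, $\pi$ a permutation) and whose morphisms are embeddings (injective maps preserving the operations and preserving and reflecting the order). A class of finite ordered structures, viewed as a category with embeddings as morphisms, is a Ramsey age if it is closed under isomorphisms and under taking substructures, has the joint embedding property (any two members embed into a common member), and has the Ramsey property: for every $k\ge2$ and all members $\mathcal{A},\mathcal{B}$ with an embedding $\mathcal{A}\to\mathcal{B}$ there is a member $\mathcal{C}$ such that $\mathcal{B}$ embeds into $\mathcal{C}$ and for every coloring of the set of embeddings $\mathcal{A}\to\mathcal{C}$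 with $k$ colors there is an embedding $w:\mathcal{B}\to\mathcal{C}$ such that $\{w\circ f: f \text{ an embedding } \mathcal{A}\to\mathcal{B}\}$ is monochromatic. *)

(* Defs.v *)
From HB Require Import structures.
From mathcomp Require Import all_boot fingroup perm.
Set Implicit Arguments. Unset Strict Implicit. Unset Printing Implicit Defensive.

Section Structures.
Variables (I : Type) (ar : I -> nat).

Inductive term (n : nat) : Type :=
| Var of 'I_n
| App (i : I) of ('I_(ar i) -> term n).

Fixpoint term_eval (A : Type) (op : forall i, ('I_(ar i) -> A) -> A)
  (n : nat) (x : 'I_n -> A) (t : term n) : A :=
  match t with
  | Var j => x j
  | App i args => op i (fun j => term_eval op x (args j))
  end.

Definition primal (A : finType) (op : forall i, ('I_(ar i) -> A) -> A) : Prop :=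
  1 < #|A| /\
  forall (n : nat) (f : ('I_n.+1 -> A) -> A),
    exists t : term n.+1, forall x, term_eval op x t = f x.

Definition strict_linear (A : Type) (lt : rel A) : Prop :=
  irreflexive lt /\ transitive lt /\ (forall x y, x = y \/ lt x y \/ lt y x).

Definition linear_order (A : Type) (le : rel A) : Prop :=
  reflexive le /\ antisymmetric le /\ transitive le /\ total le.

Record ostr := OStr {
  ocar :> finType;
  oop : forall i, ('I_(ar i) -> ocar) -> ocar;
  ole : rel ocar }.

Definition embedding (B C : ostr) (f : B -> C) : Prop :=
  injective f /\
  (forall i (args : 'I_(ar i) -> B), f (oop args) = oop (fun j => f (args j))) /\
  (forall x y, ole x y = ole (f x) (f y)).

Definition emb (B C : ostr) := {f : B -> C | embedding f}.

Lemma embedding_comp (B C D : ostr) (g : C -> D) (f : B -> C) :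
  embedding g -> embedding f -> embedding (g \o f).
Proof.
move=> [gi [go gl]] [fi [fo fl]]; split; first exact: inj_comp.
split=> [i args|x y] /=; first by rewrite fo go.
by rewrite fl gl.
Qed.

Definition emb_comp (B C D : ostr) (g : emb C D) (f : emb B C) : emb B D :=
  exist _ (sval g \o sval f) (embedding_comp (svalP g) (svalP f)).

Definition embeds (B C : ostr) : Prop := exists f : B -> C, embedding f.

Definition isomorphic (B C : ostr) : Prop :=
  exists f : B -> C, embedding f /\ bijective f.

Definition op_closed (B : ostr) (S : {set B}) : Prop :=
  forall i (args : 'I_(ar i) -> B), (forall j, args j \in S) -> oop args \in S.

Section Sub.
Variables (B : ostr) (S : {set B}) (hS : op_closed S).
Definition sub_car : finType := {x : B | x \in S}.
Definition sub_op i (args : 'I_(ar i) -> sub_car) : sub_car :=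
  exist _ (oop (fun j => sval (args j))) (hS (fun j => svalP (args j))).
Definition sub_ostr : ostr :=
  @OStr sub_car sub_op (fun x y => ole (sval x) (sval y)).
End Sub.

Definition ramsey_age (K : ostr -> Prop) : Prop :=
  (forall B, K B -> linear_order (@ole B)) /\
  (forall B C, K B -> isomorphic B C -> K C) /\
  (forall (B : ostr) (S : {set B}) (hS : op_closed S),
      K B -> S != set0 -> K (sub_ostr hS)) /\
  (forall B C, K B -> K C -> exists D, K D /\ embeds B D /\ embeds C D) /\
  (forall (k : nat) (A B : ostr), 2 <= k -> K A -> K B -> embeds A B ->
     exists C, K C /\ embeds B C /\
       forall chi : emb A C -> 'I_k,
         exists w : emb B C, exists c : 'I_k,
           forall f : emb A B, chi (emb_comp w f) = c).

Section Power.
Variables (A : finType) (op : forall i, ('I_(ar i) -> A) -> A) (lt : rel A).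

Definition pow_op (n : nat) i (args : 'I_(ar i) -> {ffun 'I_n -> A})
  : {ffun 'I_n -> A} := [ffun t => op (fun j => args j t)].

Definition antilex_lt (n : nat) (pi : 'S_n) (x y : {ffun 'I_n -> A}) : bool :=
  [exists s : 'I_n, [forall t : 'I_n, (s < t)%N ==> (x (pi t) == y (pi t))]
                     && lt (x (pi s)) (y (pi s))].

Definition antilex_le (n : nat) (pi : 'S_n) : rel {ffun 'I_n -> A} :=
  fun x y => (x == y) || antilex_lt pi x y.

Definition pow_ostr (n : nat) (pi : 'S_n) : ostr :=
  @OStr {ffun 'I_n -> A} (@pow_op n) (antilex_le pi).

Definition OV_fin : ostr -> Prop :=
  fun C => exists (n : nat) (pi : 'S_n), 0 < n /\ isomorphic (pow_ostr pi) C.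
End Power.
End Structures.

(* Main.v *)
(* By primality, a homomorphism between powers of the algebra acts by selecting
   coordinates, i.e. it is x |-> x o s for a map s of index sets, and it respects
   the (reversed) antilexicographic orders exactly when the first occurrences of
   the values of s come in increasing order. So embeddings are rigid surjections
   and the Ramsey property is the dual Ramsey theorem of Graham and Rothschild.
   Rigid surjections are coded as parameter words. The induction on the number
   of parameters first makes the colour of a word depend only on what precedes
   its first parameter, and then removes this dependence by a Hales-Jewett
   argument on the lengths of prefixes; Hales-Jewett itself is proved by Shelah's
   method of identifying one pair of letters at a time. *)
From Stdlib Require Import FunctionalExtensionality ProofIrrelevance Classical.
Require Import Defs.
From mathcomp Require Import all_boot fingroup perm.
From mathcomp Require Import zify.
Set Implicit Arguments. Unset Strict Implicit. Unset Printing Implicit Defensive.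

(** * Parameter words and substitution *)

(* Parameter words over the alphabet [0 .. a-1] with parameters [a .. b-1]:
   every parameter occurs, and first occurrences come in increasing order. *)
Fixpoint rgs (a b : nat) (w : seq nat) : bool :=
  if w is x :: w' then
    if x < a then rgs a b w' else (x == a) && rgs a.+1 b w'
  else a == b.

(* [s] holds the values of the letters of [w] already met; each new letter
   takes its value from [u], and the result stops where [u] is exhausted. *)
Fixpoint fill (s u w : seq nat) : seq nat :=
  if w is x :: w' then
    if x < size s then nth 0 s x :: fill s u w'
    else if u is y :: u' then y :: fill (rcons s y) u' w' else [::]
  else [::].

(** Letters below [a] are constants standing for themselves. A short [u] gives the instance cut off
    before the first letter without a value. *)
Definition inst (a : nat) := fill (iota 0 a).

Lemma rgs_le a b w : rgs a b w -> a <= b <= a + size w.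
Proof.
elim: w a => [|x w IH] a /=; first by move/eqP->; lia.
by case: ifP => _ => [/IH|/andP[_ /IH]]; lia.
Qed.

Lemma rgs_nseq0 a k j : 0 < a + k -> rgs a (a + k) (iota a k ++ nseq j 0).
Proof.
elim: k a => [|k IH] a /=.
  by rewrite addn0; elim: j => [|j IH] h //=; rewrite h IH.
by move=> h; rewrite ltnn eqxx -addSnnS IH //; lia.
Qed.

(** Renaming by [bump a] frees the letter [a] and keeps the order of the others. *)
Lemma rgs_bump a s b w :
  a <= s -> rgs s b w -> rgs s.+1 b.+1 (map (bump a) w).
Proof.
elim: w s => [|x w IH] s le_as /=; first by move/eqP->.
rewrite /bump; case: ltnP => [lt_xs|le_sx].
  by move/(IH _ le_as); have -> : (a <= x) + x < s.+1 by lia.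
case/andP=> /eqP-> /(IH _ (leqW le_as)) h.
have -> : (a <= s) + s < s.+1 = false by lia.
by rewrite h andbT; apply/eqP; lia.
Qed.

Lemma size_fill s u w b :
  rgs (size s) b w -> b <= size s + size u -> size (fill s u w) = size w.
Proof.
elim: w s u => [|x w IH] s u //=.
case: ltnP => [_ h hb|_ /andP[_ h]] /=; first by rewrite (IH _ _ h).
case: u => [|y u] /=; first by have := rgs_le h; lia.
by move=> hb; rewrite (IH (rcons s y)) ?size_rcons //; lia.
Qed.

Lemma all_fill a s u w :
  all (gtn a) s -> all (gtn a) u -> all (gtn a) (fill s u w).
Proof.
elim: w s u => [|x w IH] s u //= hs hu.
case: ltnP => [lt_x|_] /=; first by have /= -> := all_nthP 0 hs _ lt_x; rewrite IH.
by case: u hu => [|y u] //= /andP[hy hu]; rewrite /= hy IH // all_rcons /= hy.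
Qed.

Lemma map_fill f s u w : map f (fill s u w) = fill (map f s) (map f u) w.
Proof.
elim: w s u => [|x w IH] s u //=; rewrite size_map.
case: ltnP => [lt_x|_]; first by rewrite /= IH (nth_map 0).
by case: u => [|y u] //=; rewrite IH map_rcons.
Qed.

Lemma size_fill_le s u w : size (fill s u w) <= size w.
Proof.
elim: w s u => [|x w IH] s u //=; case: ifP => //= _; first exact: IH.
by case: u => //= y u; exact: IH.
Qed.

(* Substitution is associative, including when a word stops early because it
   runs out of letters. *)
Lemma fill_assoc s1 s2 u v w b :
  all (gtn (size s2)) s1 -> rgs (size s2) b v ->
  fill s2 u (fill s1 v w) = fill (map (nth 0 s2) s1) (fill s2 u v) w.
Proof.
elim: w s1 s2 u v => [|x w IH] s1 s2 u v hs hv //=.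
rewrite size_map; case: ltnP => [lt_x|_] /=.
  have lt_y : nth 0 s1 x < size s2 by apply: (all_nthP 0 hs).
  by rewrite lt_y (nth_map 0) // (IH s1).
case: v hv => [|y v] //=; case: ltnP => [lt_y|_] /=.
  by move=> hv; rewrite (IH (rcons s1 y)) ?map_rcons // all_rcons /= lt_y.
case/andP=> /eqP-> hv; case: u => [|z u] //=; congr (_ :: _).
rewrite IH ?size_rcons ?all_rcons /= ?ltnSn //=; last first.
  by apply: sub_all hs => i /=; lia.
rewrite map_rcons nth_rcons ltnn eqxx; congr (fill (rcons _ _) _ _).
by apply/eq_in_map => i /(allP hs) /= lt_i; rewrite nth_rcons lt_i.
Qed.

Lemma all_iota a : all (gtn a) (iota 0 a).
Proof. by apply/allP => i; rewrite mem_iota. Qed.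

Lemma map_nth_iota s : map (nth 0 s) (iota 0 (size s)) = s.
Proof. by rewrite -/(mkseq _ _) mkseq_nth. Qed.

Lemma inst_assoc a u v w b :
  rgs a b v -> inst a u (inst a v w) = inst a (inst a u v) w.
Proof.
move=> hv; rewrite /inst (@fill_assoc _ _ _ _ _ b) ?size_iota ?all_iota //.
by have := map_nth_iota (iota 0 a); rewrite size_iota => ->.
Qed.

(** Values copied from [s] are below [m], hence nothing new, and the entries of [v] are consumed in
    order. The condition on [b] makes [w] use up all of [v]. *)
Lemma rgs_fill s m b b' v w :
  all (gtn m) s -> rgs (size s) b w -> b = size s + size v ->
  rgs m b' v -> rgs m b' (fill s v w).
Proof.
elim: w s m v => [|x w IH] s m v hs /=.
  by move/eqP-> => h; case: v h => // y v /=; lia.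
case: ltnP => [lt_x hw hb hv|_ /andP[_ hw]] /=.
  by have /= -> := all_nthP 0 hs _ lt_x; apply: IH.
case: v => [|y v] /= hb; first by have := rgs_le hw; lia.
case: ltnP => [lt_y hv|_ /andP[/eqP-> hv]] /=.
  by apply: IH hv; rewrite ?all_rcons ?size_rcons /= ?lt_y //; lia.
rewrite eqxx /=; apply: IH hv; rewrite ?all_rcons ?size_rcons /= ?ltnSn //.
- by apply: sub_all hs => i /=; lia.
- by lia.
Qed.

Lemma rgs_inst a n b v w :
  rgs a (a + n) w -> size v = n -> rgs a b v -> rgs a b (inst a v w).
Proof.
by move=> hw hn; apply: (@rgs_fill _ _ (a + n)); rewrite ?size_iota ?all_iota ?hn.
Qed.

Lemma size_inst a n v w :
  rgs a (a + n) w -> n <= size v -> size (inst a v w) = size w.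
Proof. by move=> hw hn; apply: size_fill; rewrite ?size_iota; [exact: hw | lia]. Qed.

(** The renamed word never looks up place [size p], so the value [x] stored there is invisible. *)
Lemma fill_bump p x t u w :
  fill (p ++ x :: t) u (map (bump (size p)) w) = fill (p ++ t) u w.
Proof.
elim: w t u => [|y w IH] t u //=; rewrite !size_cat /= /bump.
have -> : ((size p <= y) + y < size p + (size t).+1) = (y < size p + size t).
  by lia.
case: ifP => _.
  rewrite IH !nth_cat; congr (_ :: _).
  case: (ltnP y (size p)) => [le|le]; first by rewrite [false + y]add0n le.
  have -> : true + y < size p = false by lia.
  by have -> : true + y - size p = (y - size p).+1 by lia.
by case: u => [|z u] //=; rewrite !rcons_cat /= IH.
Qed.

Lemma rgs_all a b w : rgs a b w -> all (gtn b) w.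
Proof.
elim: w a => [|x w IH] a //=.
case: ltnP => [lt_x hw|_ /andP[/eqP-> hw]];
  by have := rgs_le hw; rewrite (IH _ hw) andbT; lia.
Qed.

Lemma fill_cat s x u v w :
  rgs (size s) (size s).+1 v ->
  fill s (x :: u) (v ++ w) = fill s [:: x] v ++ fill (rcons s x) u w.
Proof.
have key t u' v' : rgs (size t) (size t) v' ->
  fill t u' (v' ++ w) = fill t [::] v' ++ fill t u' w.
  elim: v' => [|y v' IH] //=; case: ltnP => [_ /IH ->//|_ /andP[_ /rgs_le]].
  by lia.
elim: v => [|y v IH] /=; first by lia.
case: ltnP => [_ /IH -> //|_ /andP[_ hv]] /=.
by rewrite key ?size_rcons.
Qed.

(** * The Hales-Jewett theorem *)

(** With [sigma] constantly 0 this is the Hales-Jewett theorem; other maps [sigma] ask only that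
    some letters be indistinguishable, so that letters can be merged one pair at a time. *)
Definition line_ramsey (a : nat) (sigma : nat -> nat) : Prop :=
  forall C : finType, exists L, forall c : seq nat -> C, exists v,
    [/\ size v = L, rgs a a.+1 v &
        forall x, x < a -> c (inst a [:: x] v) = c (inst a [:: sigma x] v)].

(** The bound [size u <= n], instead of equality, also covers instances that are cut off; the later
    argument on prefix lengths rests on this. *)
Definition cube_ramsey (a : nat) (sigma : nat -> nat) (n : nat) : Prop :=
  forall C : finType, exists L, forall c : seq nat -> C, exists v,
    [/\ size v = L, rgs a (a + n) v &
        forall u, all (gtn a) u -> size u <= n ->
          c (inst a u v) = c (inst a (map sigma u) v)].

Fixpoint words (a m : nat) : seq (seq nat) :=
  if m is m'.+1 then [::] :: [seq x :: w | x <- iota 0 a, w <- words a m']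
  else [:: [::]].

Lemma mem_words a m w : all (gtn a) w -> size w <= m -> w \in words a m.
Proof.
elim: m w => [|m IH] [|x w] //= /andP[hx hw] hm; rewrite in_cons /=.
by apply/allpairsP; exists (x, w); rewrite mem_iota /= hx IH.
Qed.

(** Induction on the dimension: a line [v] insensitive to [sigma] under every short continuation,
    followed by a cube [w] insensitive to it for every value of the first parameter. *)
Lemma cube_ramsey_line a sigma n :
  (forall x, x < a -> sigma x < a) -> line_ramsey a sigma ->
  cube_ramsey a sigma n.
Proof.
move=> hsig line; elim: n => [|n IH] C.
  by exists 0 => c; exists [::]; split=> //=; rewrite addn0.
have [M HM] := IH {ffun 'I_a -> C}.
set ws := words a M.
have [L HL] := line {ffun 'I_(size ws) -> C}.
exists (L + M) => c.
(* A word is coloured by the colours of all its extensions by words of length at most [M], of which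
   there are finitely many. *)
have [v [sv rv cv]] := HL (fun t => [ffun i : 'I_(size ws) => c (t ++ nth [::] ws i)]).
have {}cv x t : x < a -> all (gtn a) t -> size t <= M ->
    c (inst a [:: x] v ++ t) = c (inst a [:: sigma x] v ++ t).
  move=> hx ht st; have tw := mem_words ht st.
  have hi : index t ws < size ws by rewrite index_mem.
  move/ffunP: (cv x hx) => /(_ (Ordinal hi)).
  by rewrite !ffunE /= nth_index.
have [w [sw rw cw]] := HM (fun t => [ffun x : 'I_a => c (inst a [:: val x] v ++ t)]).
have {}cw x u : x < a -> all (gtn a) u -> size u <= n ->
    c (inst a [:: x] v ++ inst a u w) =
    c (inst a [:: x] v ++ inst a (map sigma u) w).
  move=> hx hu su; move/ffunP: (cw u hu su) => /(_ (Ordinal hx)).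
  by rewrite !ffunE.
(* The parameter [a] belongs to [v]; the shift moves those of [w] past it. *)
exists (v ++ map (bump a) w); split.
- by rewrite size_cat size_map sv sw.
- have key s t : rgs s a.+1 t -> rgs s (a + n.+1) (t ++ map (bump a) w).
    elim: t s => [|y t IHt] s /=; last by case: ifP => _; [exact: IHt | case/andP=> -> /IHt].
    by move/eqP->; rewrite addnS; apply: rgs_bump.
  exact: key.
case=> [|x u] //= /andP[hx hu] su.
have E y t : inst a (y :: t) (v ++ map (bump a) w) =
             inst a [:: y] v ++ inst a t w.
  rewrite /inst fill_cat ?size_iota //; congr (_ ++ _).
  have := fill_bump (iota 0 a) y [::] t w.
  by rewrite size_iota cats1 cats0.
rewrite !E cw // cv //.
  apply: all_fill; first exact: all_iota.
  by rewrite all_map; apply: sub_all hu => y /= /hsig.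
by rewrite -sw; exact: size_fill_le.
Qed.

Definition swap_top (a x : nat) := if x == a then 0 else x.

(* Shelah's pigeonhole on the words [0^j a^(L - j)]. *)
Lemma line_ramsey_swap a : 0 < a -> line_ramsey a.+1 (swap_top a).
Proof.
move=> a0 C; exists #|C| => c.
set L := #|C|.
pose f (j : 'I_L.+1) := c (nseq j 0 ++ nseq (L - j) a).
have /injectivePn [j [j' neq_j ff]] : ~~ injectiveb f.
  by apply/injectiveP => /leq_card; rewrite card_ord ltnn.
wlog lt_j : j j' neq_j ff / j < j'.
  move=> W; case: (ltngtP j j') => [|lt|/val_inj e]; first exact: W.
    by apply: (W j' j) => //; rewrite eq_sym.
  by rewrite e eqxx in neq_j.
have lejL : j' <= L by rewrite -ltnS.
(* The value [a] for the parameter [a.+1] yields the word with [j] zeros, the value 0 the one with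
   [j'] zeros. *)
exists (nseq j 0 ++ nseq (j' - j) a.+1 ++ nseq (L - j') a).
have const s u b k y : y < size s -> fill s u (nseq k y ++ b) = nseq k (nth 0 s y) ++ fill s u b.
  by move=> hy; elim: k => [|k /= ->] //=; rewrite hy.
have appE x : inst a.+1 [:: x] (nseq j 0 ++ nseq (j' - j) a.+1 ++ nseq (L - j') a)
   = nseq j 0 ++ nseq (j' - j) x ++ nseq (L - j') a.
  rewrite /inst; move: (size_iota 0 a.+1) (@nth_iota 0 0 a.+1).
  move: (iota 0 a.+1) => s ss ns.
  rewrite const ?ss // ns // add0n; congr (_ ++ _).
  case E: (j' - j) => [|d]; first by lia.
  rewrite /= ss ltnn; congr (_ :: _).
  rewrite const ?size_rcons ?ss // nth_rcons ss ltnn eqxx; congr (_ ++ _).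
  rewrite -[nseq (L - j') a]cats0 const ?size_rcons ?ss ?ltnS ?leqnSn //.
  by rewrite nth_rcons ss ltnSn ns.
split.
- by rewrite !size_cat !size_nseq; lia.
- have: 0 < j' - j by lia.
  move: (nat_of_ord j) (j' - j) => i [|d] // _.
  elim: i => [|i IHi] //=; rewrite ltnn eqxx /=.
  elim: d => [|d IHd] /=; last by rewrite ltnSn.
  by elim: (L - j') => [|i IHi] /=; rewrite ?eqxx // ltnS leqW // leqnn.
- move=> x hx; rewrite !appE /swap_top; case: eqP => [->|] //.
  have -> : nseq (j' - j) a ++ nseq (L - j') a = nseq (L - j) a.
    by rewrite -nseqD; congr nseq; lia.
  rewrite catA -nseqD subnKC ?(ltnW lt_j) //.
Qed.

(** Induction on the alphabet: inside a cube whose colours cannot tell the top letter from 0, a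
    monochromatic line for the smaller alphabet stays monochromatic for the larger one. *)
Theorem hales_jewett a : 0 < a -> line_ramsey a (fun=> 0).
Proof.
case: a => // a _; elim: a => [|a IH] C.
  by exists 1 => c; exists [:: 1]; split=> // -[].
have [n Hn] := IH C.
have cube : cube_ramsey a.+2 (swap_top a.+1) n.
  apply: cube_ramsey_line; last exact: line_ramsey_swap.
  by move=> x; rewrite /swap_top; case: eqP.
have [M HM] := cube C.
exists M => c; have [w [sw rw cw]] := HM c.
have [v [sv rv cv]] := Hn (fun t => c (inst a.+2 t w)).
(* The parameter [a.+1] of [v] is a constant of the larger alphabet, so it is renamed to [a.+2]. *)
have rv' : rgs a.+2 a.+3 (map (bump a.+1) v) by apply: rgs_bump.
exists (inst a.+2 (map (bump a.+1) v) w); split.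
- by rewrite (size_inst rw) // size_map sv.
- by apply: rgs_inst rw _ rv'; rewrite size_map.
have key x : x < a.+2 -> map (swap_top a.+1) (inst a.+2 [:: x] (map (bump a.+1) v))
   = inst a.+1 [:: swap_top a.+1 x] v.
  move=> hx; have := fill_bump (iota 0 a.+1) a.+1 [::] [:: x] v.
  have <- : iota 0 a.+2 = iota 0 a.+1 ++ [:: a.+1] by rewrite -addn1 iotaD.
  rewrite size_iota cats0 /inst => ->; rewrite map_fill; congr fill.
  rewrite -[RHS]map_id; apply/eq_in_map => y; rewrite mem_iota /swap_top.
  by case: eqP => // ->; rewrite add0n ltnn.
have main x : x < a.+2 ->
    c (inst a.+2 [:: x] (inst a.+2 (map (bump a.+1) v) w)) = c (inst a.+2 (inst a.+1 [:: 0] v) w).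
  move=> hx; rewrite (inst_assoc _ _ rv') cw ?key //.
  - rewrite cv // /swap_top; case: eqP => // /eqP; lia.
  - by apply: all_fill; rewrite ?all_iota //= hx.
  - by apply: leq_trans (size_fill_le _ _ _) _; rewrite size_map sv.
by move=> x hx; rewrite !main.
Qed.

(** * Making the colours of truncated instances equal *)

Lemma size_count_colors (C : finType) (T : Type) (e : T -> C) (s : seq T) :
  \sum_(z : C) count (fun x => e x == z) s = size s.
Proof.
elim: s => [|x s IH] /=; first by rewrite big1.
rewrite big_split /= IH (bigD1 (e x)) //= eqxx big1 ?addn0 // => z.
by rewrite eq_sym => /negbTE ->.
Qed.

(* The word introducing its [n] letters at the first [n] marked positions. *)
Fixpoint mark (a n : nat) (b : seq bool) : seq nat :=
  match b, n with
  | true :: b', n'.+1 => a :: mark a.+1 n' b'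
  | _ :: b', _ => 0 :: mark a n b'
  | [::], _ => [::]
  end.

Lemma size_mark a n b : size (mark a n b) = size b.
Proof. by elim: b a n => [|[] b IH] a [|n] //=; rewrite IH. Qed.

Lemma rgs_mark a n b : 0 < a -> n <= count id b -> rgs a (a + n) (mark a n b).
Proof.
elim: b a n => [|[] b IH] a [|n] //= a0; rewrite ?a0 ?addn0 ?add0n //; first last.
- exact: IH.
- by move=> _; have := IH a 0 a0 isT; rewrite addn0.
- by rewrite ltnn eqxx -addSnnS; exact: IH.
- by move=> _; have := IH a 0 a0 isT; rewrite addn0.
Qed.

(** Filling stops where the first letter without a value is introduced, and letters are introduced
    only at marked positions. *)
Lemma mark_stop s u n b :
  0 < size s -> size u < n -> n <= count id b ->
  nth false b (size (fill s u (mark (size s) n b))).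
Proof.
elim: b s u n => [|[] b IH] s u [|n] //= s0; last first.
  by rewrite s0 /=; exact: IH.
case: u => [|y u] /=; rewrite ltnn //= => hu hn.
by have := IH (rcons s y) u n; rewrite size_rcons; apply.
Qed.

(** On a Hales-Jewett cube the colour of a truncated instance depends only on where it is cut.
    Parameters are then introduced only at positions of one colour, so that cuts happen only
    there. *)
Lemma monochromatic_levels a n (C : finType) : 0 < a ->
  exists M, forall d : seq nat -> C, exists w,
    [/\ size w = M, rgs a (a + n) w &
        forall u u', all (gtn a) u -> all (gtn a) u' -> size u < n ->
          size u' < n -> d (inst a u w) = d (inst a u' w)].
Proof.
(* One position more than [#|C| * n] forces some colour to occur at least [n] times. *)
move=> a0; set N := (#|C| * n).+1.
have cube : cube_ramsey a (fun=> 0) N.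
  by apply: cube_ramsey_line => //; exact: hales_jewett.
have [M HM] := cube C.
exists M => d; have [w [sw rw cw]] := HM d.
pose e i := d (inst a (nseq i 0) w).
have [z hz] : exists z, n <= count (fun i => e i == z) (iota 0 N).
  apply/existsP; rewrite -[[exists _, _]]negbK negb_exists; apply/negP => /forallP H.
  have := size_count_colors e (iota 0 N); rewrite size_iota => E.
  have : \sum_(z : C) count (fun i => e i == z) (iota 0 N) <= \sum_(z : C) n.
    by apply: leq_sum => z _; rewrite ltnW // ltnNge H.
  by rewrite E sum_nat_const cardT -cardE ltnn.
pose b := [seq e i == z | i <- iota 0 N].
have hb : n <= count id b by rewrite count_map.
pose v := mark a n b.
have rv : rgs a (a + n) v by apply: rgs_mark.
have sv : size v = N by rewrite size_mark size_map size_iota.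
exists (inst a v w); split.
- by rewrite (size_inst rw) ?sv.
- exact: rgs_inst rw sv rv.
have main u : all (gtn a) u -> size u < n -> d (inst a u (inst a v w)) = z.
  (* All letters of [inst a u v] may be replaced by 0, so only its length matters, and that is a
     marked position. *)
  move=> hu su; rewrite (inst_assoc _ _ rv) cw.
  - have -> : map (fun=> 0) (inst a u v) = nseq (size (inst a u v)) 0.
      by elim: (inst _ _ _) => //= x t ->.
    have := @mark_stop (iota 0 a) u n b; rewrite size_iota -/v -/(inst a u v).
    move/(_ a0 su hb) => hn.
    have lt : size (inst a u v) < N.
      rewrite ltnNge; apply/negP => le; move: hn.
      by rewrite nth_default // size_map size_iota.
    by move: hn; rewrite (nth_map 0) ?size_iota // nth_iota // => /eqP.
  - by apply: all_fill; rewrite ?all_iota.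
  - by rewrite -sv; exact: size_fill_le.
by move=> u u' hu hu' su su'; rewrite !main.
Qed.

(** * The Graham-Rothschild theorem for parameter words *)

Definition graham_rothschild (k : nat) : Prop :=
  forall a n (C : finType), 0 < a ->
  exists m, forall c : seq nat -> C, exists w,
    [/\ size w = m, rgs a (a + n) w &
        forall u u', size u = n -> size u' = n ->
          rgs a (a + k) u -> rgs a (a + k) u' ->
          c (inst a u w) = c (inst a u' w)].

(* Makes the colour of [t a v], where [a] is the first parameter to occur,
   independent of [v]: a word [v] with [k] parameters over one more letter. *)
Lemma graham_rothschild_tail k a M (C : finType) :
  graham_rothschild k ->
  exists N, forall c : seq nat -> C, exists w,
    [/\ size w = N, rgs a (a + M) w &
        forall t v v', all (gtn a) t -> size t + (size v).+1 = M ->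
          size v' = size v -> rgs a.+1 (a.+1 + k) v -> rgs a.+1 (a.+1 + k) v' ->
          c (inst a (t ++ a :: v) w) = c (inst a (t ++ a :: v') w)].
Proof.
move=> GR; elim: M C => [|M IH] C.
  by exists 0 => c; exists [::]; split=> //=; rewrite addn0.
have [M1 H1] := IH {ffun 'I_a -> C}.
(* For words beginning with [a], this letter is one more constant for the rest, hence the alphabet
   of size [a.+1]. *)
have [m Hm] := GR a.+1 M1 C isT.
exists m.+1 => c.
have [w1 [sw1 rw1 cw1]] := Hm (fun t => c (a :: t)).
(* For words beginning with a constant [x], one colour records all choices of [x]. *)
have [w2 [sw2 rw2 cw2]] := H1 (fun t =>
  [ffun x : 'I_a => c (val x :: fill (rcons (iota 0 a) x) t w1)]).
have rw2' : rgs a.+1 (a.+1 + M) (map (bump a) w2) by rewrite addSn; apply: rgs_bump.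
have iotaS : iota 0 a.+1 = rcons (iota 0 a) a by rewrite -addn1 iotaD cats1.
(* The new parameter comes first; [w2], shifted past it, is substituted into [w1]. *)
exists (a :: inst a.+1 (map (bump a) w2) w1); split.
- by rewrite /= (size_inst rw1) ?sw1 // size_map sw2.
- by rewrite /= ltnn eqxx addnS -addSn; apply: rgs_inst rw1 _ rw2'; rewrite size_map.
have E x t : inst a (x :: t) (a :: inst a.+1 (map (bump a) w2) w1) =
    x :: fill (rcons (iota 0 a) x) (fill (rcons (iota 0 a) x) t (map (bump a) w2)) w1.
  have ss : size (rcons (iota 0 a) x) = a.+1 by rewrite size_rcons size_iota.
  rewrite {1}/inst /= size_iota ltnn (@fill_assoc _ _ _ _ _ (a.+1 + M)).
  - by rewrite -{1}ss map_nth_iota.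
  - by rewrite ss all_iota.
  - by rewrite ss.
case=> [|x t] v v' ht st sv' rv rv'.
  have sv : size v = M by case: st.
  rewrite !cat0s !E -iotaS; apply: cw1; first last.
  - by apply: rgs_inst rw2' _ rv'; rewrite sv'.
  - exact: rgs_inst rw2' _ rv.
  - by rewrite (size_inst rw2') ?size_map ?sv' ?sv.
  - by rewrite (size_inst rw2') ?size_map ?sv.
have /andP[hx {}ht] := ht.
have F u : fill (rcons (iota 0 a) x) u (map (bump a) w2) = inst a u w2.
  by have := fill_bump (iota 0 a) x [::] u w2; rewrite size_iota cats1 cats0.
have st' : size t + (size v).+1 = M by case: st.
have /ffunP/(_ (Ordinal hx)) := cw2 t v v' ht st' sv' rv rv'.
by rewrite !ffunE !cat_cons !E !F.
Qed.

Lemma rgs_split a k u : rgs a (a + k.+1) u ->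
  exists t v, [/\ u = t ++ a :: v, all (gtn a) t & rgs a.+1 (a.+1 + k) v].
Proof.
elim: u => [|x u IH] /=; first by lia.
case: ltnP => [lt_x /IH[t [v [-> ht hv]]]|_ /andP[/eqP-> hu]].
  by exists (x :: t), v; rewrite /= lt_x.
by exists [::], u; rewrite addSnnS.
Qed.

(** The instance by [t] alone breaks off exactly where the longer one first shows [a], so what
    precedes [a] does not depend on [v]. *)
Lemma fill_split a n b t v w s :
  0 < a -> all (gtn a) s -> all (gtn a) t -> rgs a.+1 b v ->
  rgs (size s) (size s + n) w -> size t + (size v).+1 = n ->
  exists v', [/\ fill s (t ++ a :: v) w = fill s t w ++ a :: v' & rgs a.+1 b v'].
Proof.
move=> a0 + + hv; elim: w s n t => [|x w IH] s n t hs ht /=; first by lia.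
case: ltnP => [lt_x hw hn|_ /andP[_ hw] hn].
  by have [v' [-> hv']] := IH s n t hs ht hw hn; exists v'.
case: t ht hn => [|y t] /= ht hn.
  exists (fill (rcons s a) v w); split=> //; apply: (rgs_fill (b := size s + n)) => //.
  - by rewrite all_rcons /= ltnSn; apply: sub_all hs => i /=; lia.
  - by rewrite size_rcons.
  - by rewrite size_rcons -hn; lia.
have /andP[hy {}ht] := ht.
have [] := IH (rcons s y) n.-1 t; rewrite ?all_rcons ?size_rcons /= ?hy //.
- by have -> : (size s).+1 + n.-1 = size s + n by lia.
- by rewrite -hn.
- by move=> v' [-> hv']; exists v'.
Qed.

Theorem graham_rothschild_all k : graham_rothschild k.
Proof.
elim: k => [|k IH] a n C a0.
  (* With no parameters each [u] consists of constants and is coloured like the zero word. *)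
  have cube : cube_ramsey a (fun=> 0) n.
    by apply: cube_ramsey_line => //; exact: hales_jewett.
  have [M HM] := cube C; exists M => c; have [w [sw rw cw]] := HM c.
  exists w; split=> // u u' su su'; rewrite addn0 => /rgs_all hu /rgs_all hu'.
  rewrite cw ?su // [RHS]cw ?su' //; congr (c (inst a _ w)).
  by apply: (@eq_from_nth _ 0) => [|i]; rewrite !size_map ?su // => hi;
    rewrite !(nth_map 0) ?su ?su'.
have [M HM] := monochromatic_levels n C a0.
have [N HN] := graham_rothschild_tail a M C IH.
exists N => c; have [w [sw rw cw]] := HN c.
(* By the choice of [w] any admissible tail gives the same colour; fixing one makes the colour a
   function of the prefix. The zeros pad to total length [M]. *)
pose tail j := iota a.+1 k ++ nseq (M - j.+1 - k) 0.
have [v [sv rv cv]] := HM (fun t => c (inst a (t ++ a :: tail (size t)) w)).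
exists (inst a v w); split.
- by rewrite (size_inst rw) ?sv.
- exact: rgs_inst rw sv rv.
have main u : size u = n -> rgs a (a + k.+1) u -> exists t,
    [/\ all (gtn a) t, size t < n & c (inst a u (inst a v w)) =
      c (inst a (inst a t v ++ a :: tail (size (inst a t v))) w)].
  move=> su ru; have [t [v1 [eu ht rv1]]] := rgs_split ru.
  exists t; rewrite (inst_assoc _ _ rv); split=> //.
    by rewrite -su eu size_cat /=; lia.
  have ss : size (iota 0 a) = a by rewrite size_iota.
  have [] := @fill_split a n (a.+1 + k) t v1 v (iota 0 a) a0 (all_iota a) ht rv1.
  - by rewrite ss.
  - by rewrite -su eu size_cat.
  rewrite -!/(inst _ _ _) => v' [E rv'].
  have sE : size (inst a t v) + (size v').+1 = M.
    by rewrite -sv -(size_inst (v := u) rv) ?su // eu E size_cat.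
  rewrite eu {}E; apply: cw => //.
  - by apply: all_fill; rewrite ?all_iota.
  - by have := rgs_le rv'; rewrite /tail size_cat size_iota size_nseq; lia.
  - exact: rgs_nseq0.
move=> u u' su su' /(main _ su)[t [ht st ->]] /(main _ su')[t' [ht' st' ->]].
exact: cv.
Qed.

(** * Rigid surjections and the dual Ramsey theorem *)

Lemma rgsP a b w : a <= b ->
  rgs a b w <->
  all (gtn b) w /\ forall i, a <= i < b ->
    exists j, [/\ j < size w, nth 0 w j = i & forall t, t < j -> nth 0 w t < i].
Proof.
move=> le_ab; split=> [h|].
  split; first exact: rgs_all h.
  elim: w a h {le_ab} => [|x w IH] a /=; first by move/eqP->; lia.
  case: ltnP => [lt_x /IH{}IH i hi|_ /andP[/eqP-> /IH{}IH] i hi].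
    have [j [sj ej hj]] := IH i hi; exists j.+1.
    by split=> // -[|t] /=; [lia | exact: hj].
  have [<-|ne] := eqVneq a i; first by exists 0.
  have [|j [sj ej hj]] := IH i; first by lia.
  by exists j.+1; split=> // -[|t] /=; [lia | exact: hj].
elim: w a le_ab => [|x w IH] a le_ab /= [hw H].
  by apply/negPn/negP => ne; have [|j []] := H a; first lia.
have /andP[hx {}hw] := hw.
case: ltnP => [lt_x|le_x].
  apply: IH => //; split=> // i hi; have [[|j] /= [sj ej hj]] := H i hi; first lia.
  by exists j; split=> // t ht; apply: (hj t.+1).
have [|[|j] /= [sj ej hj]] := H a; first lia; last by have := hj 0 isT => /=; lia.
rewrite ej eqxx /=; apply: IH; first lia; split=> // i hi.
have [|[|j] /= [sj' ej' hj']] := H i; [lia|lia|].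
by exists j; split=> // t ht; apply: (hj' t.+1).
Qed.

(** While [u] does not run out, every lookup agrees with one in the final table [s ++ u]; so
    substitution is composition of maps. *)
Lemma fill_map s u w b :
  rgs (size s) b w -> b <= size s + size u -> fill s u w = map (nth 0 (s ++ u)) w.
Proof.
elim: w s u => [|x w IH] s u //=.
case: ltnP => [lt_x h hb|_ /andP[/eqP-> h] hb].
  by rewrite (IH _ _ h) // nth_cat lt_x.
case: u hb => [|y u] /= hb; first by have := rgs_le h; lia.
rewrite nth_cat ltnn subnn /= (IH (rcons s y)) ?size_rcons ?cat_rcons //; lia.
Qed.

(** A rigid surjection: [j] is the least element of the fibre over [i], and these minima increase
    with [i]. *)
Definition rigid m n (s : 'I_m -> 'I_n) : Prop :=
  forall i : 'I_n, exists2 j : 'I_m, s j = i & forall t : 'I_m, t < j -> s t < i.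

Definition word_of m n (s : 'I_m -> 'I_n) : seq nat :=
  [seq val (s j) | j <- enum 'I_m].

Lemma size_word_of m n (s : 'I_m -> 'I_n) : size (word_of s) = m.
Proof. by rewrite size_map size_enum_ord. Qed.

Lemma nth_word_of m n (s : 'I_m -> 'I_n) (j : 'I_m) : nth 0 (word_of s) j = s j.
Proof. by rewrite (nth_map j) ?size_enum_ord ?nth_ord_enum. Qed.

Lemma rigid_rgs m n (s : 'I_m -> 'I_n) : rigid s <-> rgs 0 n (word_of s).
Proof.
rewrite rgsP // size_word_of; split=> [hs|[_ hs] i].
  split=> [|i hi]; first by apply/allP => _ /mapP[j _ ->] /=.
  have [j ej hj] := hs (Ordinal hi); exists j; split=> //; first by rewrite nth_word_of ej.
  move=> t lt_t; have lt_tm := ltn_trans lt_t (ltn_ord j).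
  by rewrite -[t]/(val (Ordinal lt_tm)) nth_word_of; apply: hj.
have [|j [lt_j ej hj]] := hs i; first by rewrite ltn_ord.
exists (Ordinal lt_j) => [|t lt_t].
  by apply/val_inj; rewrite /= -ej -[j]/(val (Ordinal lt_j)) nth_word_of.
by rewrite -nth_word_of; apply: hj.
Qed.

(** The word of a rigid surjection begins with 0; dropping this letter leaves a parameter word over
    the one-letter alphabet, the case [a = 1] of Graham-Rothschild. *)
Theorem dual_ramsey k n (C : finType) :
  exists m, forall c : {ffun 'I_m.+1 -> 'I_k.+1} -> C,
  exists2 w : 'I_m.+1 -> 'I_n.+1, rigid w &
    forall s s' : 'I_n.+1 -> 'I_k.+1, rigid s -> rigid s' ->
      c [ffun j => s (w j)] = c [ffun j => s' (w j)].
Proof.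
have [m Hm] := graham_rothschild_all k n C (ltn0Sn 0).
exists m => c.
(* The defaults of [inord] and [nth] only affect sequences that do not come from rigid maps. *)
have [v [sv rv cv]] := Hm (fun l => c [ffun j : 'I_m.+1 => inord (nth 0 (0 :: l) j)]).
pose w (j : 'I_m.+1) : 'I_n.+1 := inord (nth 0 (0 :: v) j).
have rv0 : rgs 0 n.+1 (0 :: v) by [].
have lt_v j : nth 0 (0 :: v) j < n.+1.
  have := rgs_all rv0; case: (ltnP j (size (0 :: v))) => [hj /all_nthP|le _].
    by apply.
  by rewrite nth_default.
have ww : word_of w = 0 :: v.
  apply: (@eq_from_nth _ 0) => [|j]; rewrite size_word_of /= ?sv // => hj.
  by rewrite -[j]/(val (Ordinal hj)) nth_word_of inordK.
exists w; first by apply/rigid_rgs; rewrite ww.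
have main s : rigid s -> exists u, [/\ size u = n, rgs 1 (1 + k) u &
    [ffun j => s (w j)] = [ffun j : 'I_m.+1 => inord (nth 0 (0 :: inst 1 u v) j)] :> {ffun 'I_m.+1 -> 'I_k.+1}].
  move=> /rigid_rgs rs; have ss := size_word_of s.
  case es : (word_of s) rs ss => [|x u] //= /andP[/eqP ex ru] [su].
  rewrite ex in es; exists u; split=> //; apply/ffunP => j; rewrite !ffunE; apply/val_inj.
  have -> : 0 :: inst 1 u v = fill [::] (0 :: u) (0 :: v) by [].
  rewrite (@fill_map [::] _ _ n.+1) //= ?su // -[0 :: map _ v]/(map (nth 0 (0 :: u)) (0 :: v)).
  rewrite (nth_map 0) /= ?sv // -es.
  by rewrite -ww nth_word_of nth_word_of inord_val.
move=> s s' /main[u [su ru ->]] /main[u' [su' ru' ->]].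
exact: cv.
Qed.

(** * Isomorphisms and lexicographic powers *)

Section Algebra.
Variables (I : Type) (ar : I -> nat).

Lemma hom_term (B C : ostr ar) (f : B -> C) n (X : 'I_n -> B) (t : term ar n) :
  (forall i (args : 'I_(ar i) -> B), f (oop args) = oop (fun j => f (args j))) ->
  f (term_eval (@oop _ _ B) X t) = term_eval (@oop _ _ C) (fun j => f (X j)) t.
Proof.
move=> hf; elim: t => [j|i args IH] //=; rewrite hf.
by congr oop; apply: functional_extensionality.
Qed.

Lemma closed_term (B : ostr ar) (S : {set B}) n (X : 'I_n -> B) (t : term ar n) :
  op_closed S -> (forall j, X j \in S) -> term_eval (@oop _ _ B) X t \in S.
Proof. by move=> hS hX; elim: t => [j|i args IH] //=; apply: hS. Qed.

Lemma embeds_trans (B C D : ostr ar) : embeds B C -> embeds C D -> embeds B D.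
Proof.
by move=> [f hf] [g hg]; exists (g \o f); exact: embedding_comp.
Qed.

Lemma isomorphic_trans (B C D : ostr ar) :
  isomorphic B C -> isomorphic C D -> isomorphic B D.
Proof.
move=> [f [hf bf]] [g [hg bg]]; exists (g \o f); split; last exact: bij_comp.
exact: embedding_comp.
Qed.

Lemma isomorphic_inv (B C : ostr ar) : isomorphic B C ->
  exists f : B -> C, exists g : C -> B,
    [/\ embedding f, embedding g, cancel f g & cancel g f].
Proof.
move=> [f [hf [g fK gK]]]; exists f, g; split=> //.
have [_ [fo fl]] := hf; split; first exact: can_inj gK.
split=> [i args|x y]; last by rewrite fl !gK.
by apply: (can_inj fK); rewrite gK fo; congr oop; apply: functional_extensionality => j; rewrite gK.
Qed.

Variables (A : finType) (op : forall i, ('I_(ar i) -> A) -> A) (lt : rel A).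
Hypotheses (primal_op : primal op) (lin : strict_linear lt).

Let pow n (pi : 'S_n) : ostr ar := pow_ostr op lt pi.

Definition rev_perm n : 'S_n := perm (@rev_ord_inj n).

(* Reversing the coordinates makes the order lexicographic. *)
Definition lexpow n : ostr ar := pow_ostr op lt (rev_perm n).

Lemma lexpow_ltP n (x y : {ffun 'I_n -> A}) :
  reflect (exists2 p : 'I_n, forall t : 'I_n, t < p -> x t = y t & lt (x p) (y p))
          (antilex_lt lt (rev_perm n) x y).
Proof.
apply: (iffP existsP) => [[s /andP[/forallP h hs]]|[p h hp]].
  exists (rev_ord s) => [t lt_t|]; last by move: hs; rewrite permE.
  have := h (rev_ord t); rewrite permE rev_ordK => /implyP/(_ _)/eqP; apply.
  by move: lt_t => /=; have := ltn_ord t; have := ltn_ord s; lia.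
exists (rev_ord p); rewrite permE rev_ordK hp andbT; apply/forallP => t.
apply/implyP => lt_t; rewrite permE; apply/eqP/h => /=.
by move: lt_t => /=; have := ltn_ord t; have := ltn_ord p; lia.
Qed.

Lemma lexpow_lt_total n (x y : {ffun 'I_n -> A}) :
  [\/ x = y, antilex_lt lt (rev_perm n) x y | antilex_lt lt (rev_perm n) y x].
Proof.
have [_ [_ tot]] := lin.
case: (pickP (fun i => x i != y i)) => [i0 hi0|h]; last first.
  by apply: Or31; apply/ffunP => i; apply/eqP; have := h i => /negbFE.
case: (@arg_minnP _ i0 (fun i => x i != y i) val hi0) => p hp pmin.
have low (t : 'I_n) : t < p -> x t = y t.
  move=> lt_t; apply/eqP/negPn/negP => /pmin; rewrite leqNgt.
  by rewrite lt_t.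
have [e|[l|l]] := tot (x p) (y p).
- by rewrite e eqxx in hp.
- by apply: Or32; apply/lexpow_ltP; exists p.
- by apply: Or33; apply/lexpow_ltP; exists p => // t /low.
Qed.

Lemma lexpow_lt_irr n (x : {ffun 'I_n -> A}) : antilex_lt lt (rev_perm n) x x = false.
Proof. by have [irr _] := lin; apply/lexpow_ltP => -[p _]; rewrite irr. Qed.

Lemma lexpow_lt_trans n : transitive (antilex_lt lt (rev_perm n)).
Proof.
have [_ [tr _]] := lin.
move=> y x z /lexpow_ltP[p hp lp] /lexpow_ltP[q hq lq]; apply/lexpow_ltP.
case: (ltngtP p q) => [lpq|lqp|/val_inj e].
- exists p => [t ht|]; first by rewrite hp // hq // (ltn_trans ht).
  by rewrite -hq.
- exists q => [t ht|]; first by rewrite hp ?hq // (ltn_trans ht).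
  by rewrite hp.
- by rewrite -{}e in hq lq; exists p => [t ht|]; [rewrite hp ?hq | exact: tr lp lq].
Qed.

Lemma lexpow_linear n : linear_order (@ole _ _ (lexpow n)).
Proof.
rewrite /= /antilex_le; split; first by move=> x; rewrite eqxx.
split=> [x y|].
  case/andP=> /predU1P[//|xy] /predU1P[//|yx].
  by have := lexpow_lt_trans xy yx; rewrite lexpow_lt_irr.
split=> [y x z|x y].
  case/predU1P=> [->//|xy] /predU1P[<-|yz]; first by rewrite xy orbT.
  by rewrite (lexpow_lt_trans xy yz) orbT.
by case: (lexpow_lt_total x y) => [->|->|->]; rewrite ?eqxx ?orbT.
Qed.

(** Permuting coordinates carries one order to the other, so one representative per exponent
    suffices. *)
Lemma pow_iso n (pi rho : 'S_n) : isomorphic (pow pi) (pow rho).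
Proof.
pose f (x : pow pi) : pow rho := [ffun i => x (pi ((rho^-1)%g i))].
pose g (x : pow rho) : pow pi := [ffun i => x (rho ((pi^-1)%g i))].
have fK : cancel f g by move=> x; apply/ffunP => i; rewrite !ffunE permK permKV.
have gK : cancel g f by move=> x; apply/ffunP => i; rewrite !ffunE permK permKV.
exists f; split; last by exists g.
split; first exact: can_inj fK.
have fE x t : f x (rho t) = x (pi t) by rewrite ffunE permK.
split=> [i args|x y].
  apply/ffunP => t; rewrite !ffunE; congr op.
  by apply: functional_extensionality => j; rewrite ffunE.
rewrite /= /antilex_le (can_eq fK); congr (_ || _).
by apply: eq_existsb => s; rewrite !fE; congr (_ && _);
  apply: eq_forallb => t; rewrite !fE.
Qed.

Lemma OV_finP (B : ostr ar) :
  OV_fin op lt B <-> exists2 n, 0 < n & isomorphic (lexpow n) B.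
Proof.
split=> [[n [pi [n0 h]]]|[n n0 h]]; last by exists n, (rev_perm n).
by exists n => //; exact: isomorphic_trans (pow_iso _ _) h.
Qed.

(** * Embeddings of powers as rigid surjections *)

Definition reindex m n (s : 'I_m -> 'I_n) (x : lexpow n) : lexpow m :=
  [ffun j => x (s j)].

Lemma order_embedding (B C : ostr ar) (f : B -> C) :
  linear_order (@ole _ _ B) -> linear_order (@ole _ _ C) -> injective f ->
  (forall x y, ole x y -> ole (f x) (f y)) -> forall x y, ole x y = ole (f x) (f y).
Proof.
move=> [_ [_ [_ tB]]] [_ [aC _]] fi hf x y; apply/idP/idP; first exact: hf.
move=> fxy; case/orP: (tB x y) => // yx; have e : f x = f y by apply: aC; rewrite fxy hf.
by rewrite -(fi _ _ e) in yx *.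
Qed.

(** Surjectivity gives injectivity. The images of [x] and [y] first differ at the first occurrence
    of the least coordinate [p] where [x] and [y] differ, since earlier values of [s] are below
    [p]. *)
Lemma reindex_embedding m n (s : 'I_m -> 'I_n) : rigid s -> embedding (reindex s).
Proof.
move=> hs.
have inj : injective (reindex s).
  move=> x y /ffunP e; apply/ffunP => i; have [j <- _] := hs i.
  by have := e j; rewrite !ffunE.
split=> //; split=> [i args|].
  apply/ffunP => t; rewrite !ffunE; congr op.
  by apply: functional_extensionality => j; rewrite ffunE.
apply: order_embedding => //; try exact: lexpow_linear.
move=> x y /= /predU1P[->|/lexpow_ltP[p hp lp]]; rewrite /antilex_le ?eqxx //.
apply/orP; right; apply/lexpow_ltP; have [j ej hj] := hs p.
by exists j; rewrite ?ffunE ?ej // => t /hj ht; rewrite !ffunE hp.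
Qed.

Lemma pow_term n m (X : 'I_m -> lexpow n) (t : term ar m) (i : 'I_n) :
  term_eval (@oop _ _ (lexpow n)) X t i = term_eval op (fun j => (X j : {ffun _ -> _}) i) t.
Proof.
elim: t => [j|k args IH] //=; rewrite ffunE; congr op.
exact: functional_extensionality.
Qed.

(** Otherwise each [i] has a counterexample [X i]. Let [g] be [a] only at the tuple of the values of
    [f (X i)] at [j]. A term for [g] evaluates to constant [b] at the [X i], as no coordinate shows
    that tuple; applying [f] gives [a = b]. *)
Lemma hom_coordinate n m (f : lexpow n.+1 -> lexpow m) (j : 'I_m) :
  (forall i (args : 'I_(ar i) -> lexpow n.+1), f (oop args) = oop (fun k => f (args k))) ->
  exists i, forall x, (f x : {ffun _ -> _}) j = (x : {ffun _ -> _}) i.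
Proof.
move=> hf; have [/card_gt1P[a [b [_ _ neq_ab]]] prim] := primal_op.
pose P (i : 'I_n.+1) := [forall x : {ffun 'I_n.+1 -> A}, (f x : {ffun _ -> _}) j == x i].
case: (pickP P) => [i /forallP h|h]; first by exists i => x; apply/eqP.
have /fin_all_exists[X hX] i : exists x : lexpow n.+1, (f x : {ffun _ -> _}) j != (x : {ffun _ -> _}) i.
  by have /negbT := h i; rewrite negb_forall => /existsP.
pose g (y : 'I_n.+1 -> A) := if [forall i, y i == (f (X i) : {ffun _ -> _}) j] then a else b.
have [t ht] := prim _ g.
(* [primal] concerns operations of positive arity, so the constant [b] becomes a unary term. *)
have [u hu] := prim 0 (fun=> b).
have e1 : term_eval (@oop _ _ (lexpow n.+1)) X t =
          term_eval (@oop _ _ (lexpow n.+1)) (fun=> X ord0) u.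
  apply/ffunP => i; rewrite !pow_term ht hu /g.
  by case: forallP => // /(_ i); rewrite eq_sym (negbTE (hX i)).
have := congr1 (fun x => (f x : {ffun _ -> _}) j) e1.
rewrite /= !(hom_term _ _ hf) !pow_term ht hu /g.
case: forallP => [_ e|[]]; last by move=> i.
by rewrite e eqxx in neq_ab.
Qed.

Lemma embedding_reindex n m (f : lexpow n.+1 -> lexpow m) : embedding f ->
  exists2 s : 'I_m -> 'I_n.+1, rigid s & f = reindex s.
Proof.
move=> [fi [fo fl]]; have [/card_gt1P[a' [b' [_ _ neq_ab']]] _] := primal_op.
have [irr [tr tot]] := lin.
have [a [b lab]] : exists a b, lt a b.
  have [e|[l|l]] := tot a' b'; first by rewrite e eqxx in neq_ab'.
    by exists a', b'.
  by exists b', a'.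
have /fin_all_exists[s hs] j := hom_coordinate j fo.
have fE : f = reindex s.
  by apply: functional_extensionality => x; apply/ffunP => j; rewrite hs ffunE.
exists s => // i.
(* Here [x < y] holds only at coordinate [i], while [x] exceeds [y] at all later ones. So the images
   first differ at a place sent to [i], and before it only values below [i] occur. *)
pose x : {ffun 'I_n.+1 -> A} := [ffun t : 'I_n.+1 => if t <= i then a else b].
pose y : {ffun 'I_n.+1 -> A} := [ffun t : 'I_n.+1 => if t == i then b else a].
have nba : lt b a = false by apply/negP => l; have := tr _ _ _ lab l; rewrite irr.
have neq_ab : a != b by apply: contraTneq lab => ->; rewrite irr.
have lxy : antilex_lt lt (rev_perm _) x y.
  apply/lexpow_ltP; exists i => [t lt_ti|]; last by rewrite !ffunE leqnn eqxx.
  by rewrite !ffunE ltnW // ifN // neq_ltn lt_ti.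
have : @ole _ _ (lexpow _) x y by rewrite /= /antilex_le lxy orbT.
rewrite fl => /predU1P[/fi e|/lexpow_ltP[j hj lj]].
  by rewrite e lexpow_lt_irr in lxy.
have sj : s j = i.
  move: lj; rewrite !hs !ffunE; case: eqP => //.
  by case: ifP; rewrite ?irr ?nba.
exists j => // t /hj; rewrite !hs !ffunE.
case: eqP => [->|ne]; first by rewrite leqnn => e; rewrite e eqxx in neq_ab.
case: (leqP (s t) i) => [le _|_ e]; last by rewrite e eqxx in neq_ab.
by rewrite ltn_neqAle le andbT; apply/eqP => /val_inj.
Qed.

Lemma isomorphic_refl (B : ostr ar) : isomorphic B B.
Proof. by exists id; split; [split; [exact: inj_id|] | exists id]. Qed.

Lemma OV_fin_lexpow n : OV_fin op lt (lexpow n.+1).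
Proof. by apply/OV_finP; exists n.+1 => //; exact: isomorphic_refl. Qed.

Lemma OV_fin_chart (B : ostr ar) : OV_fin op lt B ->
  exists n, exists f : lexpow n.+1 -> B, exists g : B -> lexpow n.+1,
    [/\ embedding f, embedding g, cancel f g & cancel g f].
Proof. by case/OV_finP=> [[|n]] // _ /isomorphic_inv; exists n. Qed.

(** * Subalgebras of powers *)

(** [L] continues [seen] by the new entries of [l] in order of first occurrence. *)
Lemma seq_rgs (T : eqType) (l seen : seq T) : exists L,
  [/\ {subset l <= L}, prefix seen L &
      rgs (size seen) (size L) (map (index^~ L) l)].
Proof.
elim: l seen => [|x l IH] seen; first by exists seen; rewrite prefix_refl /= eqxx.
have [x_in|x_out] := boolP (x \in seen).
  have [L [sL /prefixP[r eL] hL]] := IH seen; exists L.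
  split=> [y||]; last 2 first.
  - by rewrite eL prefix_prefix.
  - by rewrite /= {1}eL index_cat x_in index_mem x_in.
  rewrite inE => /predU1P[->|/sL//].
  by rewrite eL mem_cat x_in.
have [L [sL /prefixP[r eL] hL]] := IH (rcons seen x); exists L.
split=> [y||]; last 2 first.
- by rewrite eL cat_rcons prefix_prefix.
- have ix : index x L = size seen.
    by rewrite eL cat_rcons index_cat (negbTE x_out) /= eqxx addn0.
  by rewrite size_rcons in hL; rewrite /= ix ltnn eqxx.
rewrite inE => /predU1P[->|/sL//].
by rewrite eL mem_cat mem_rcons mem_head.
Qed.

Lemma rigid_quotient n (T : eqType) (f : 'I_n.+1 -> T) :
  exists m, exists2 s : 'I_n.+1 -> 'I_m.+1, rigid s &
    forall i j, s i = s j <-> f i = f j.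
Proof.
pose l := [seq f i | i <- enum 'I_n.+1].
have fl i : f i \in l by apply: map_f; rewrite mem_enum.
have [L [sL _ hL]] := seq_rgs l [::].
case E : (size L) hL => [|m] hL.
  by have := sL _ (fl ord0); rewrite (size0nil E).
have lt_i i : index (f i) L < m.+1 by rewrite -E index_mem sL.
exists m, (fun i => Ordinal (lt_i i)).
  by apply/rigid_rgs; move: hL; rewrite -map_comp.
move=> i j; split=> [/(congr1 val) /= e|e]; last by apply/val_inj; rewrite /= e.
by rewrite -(nth_index (f i) (sL _ (fl i))) e nth_index // sL.
Qed.

(* Baker-Pixley for primal algebras: a subalgebra of a power is determined by
   the coordinates that it identifies. *)
Lemma closed_lexpow n (S : {set lexpow n.+1}) : op_closed S -> S != set0 ->
  exists m, exists2 s : 'I_n.+1 -> 'I_m.+1, rigid s &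
    forall y : lexpow n.+1, y \in S <->
      forall i j, s i = s j -> (y : {ffun _ -> _}) i = (y : {ffun _ -> _}) j.
Proof.
move=> hS /set0Pn[x0 x0S]; have [_ prim] := primal_op.
(* The column of values at [i] of all members of [S]; coordinates with equal columns are
   identified. *)
pose f (i : 'I_n.+1) := [seq (x : {ffun _ -> _}) i | x : lexpow n.+1 <- enum S].
have [m [s rs hs]] := rigid_quotient f; exists m, s => // y.
split=> [yS i j /hs /eq_in_map|hy]; first by apply; rewrite mem_enum.
case E : (size (enum S)) => [|N].
  by rewrite -mem_enum (size0nil E) in x0S.
pose X (k : 'I_N.+1) : lexpow n.+1 := nth x0 (enum S) k.
have XS k : X k \in S by rewrite -mem_enum mem_nth // E.
(* The members of [S] serve as arguments: [g] sends column [i] to [y i], unambiguously since [y]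
   agrees on equal columns. Its value elsewhere is arbitrary. *)
pose g (v : 'I_N.+1 -> A) :=
  if [pick i | [forall k, v k == (X k : {ffun _ -> _}) i]] is Some i
  then (y : {ffun _ -> _}) i else (y : {ffun _ -> _}) ord0.
have [t ht] := prim _ g.
suff -> : y = term_eval (@oop _ _ (lexpow n.+1)) X t by apply: closed_term.
apply/ffunP => i; rewrite pow_term ht /g; case: pickP => [j /forallP hj|/(_ i)].
  apply/hy/hs/eq_in_map => x; rewrite mem_enum => xS.
  have lt_k : index x (enum S) < N.+1 by rewrite -E index_mem mem_enum.
  have := hj (Ordinal lt_k); rewrite /X /= nth_index ?mem_enum //.
  by move/eqP.
by move/forallP; case=> k.
Qed.

(** In a chart the subalgebra consists of the tuples constant on the fibres of [s], and [reindex s]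
    identifies it with a power. *)
Lemma OV_fin_sub (B : ostr ar) (S : {set B}) (hS : op_closed S) :
  OV_fin op lt B -> S != set0 -> OV_fin op lt (sub_ostr hS).
Proof.
move=> /OV_fin_chart[n [f [g [hf hg fK gK]]]] /set0Pn[b bS].
have [fi [fo fl]] := hf.
pose S' : {set lexpow n.+1} := [set x : lexpow n.+1 | f x \in S].
have hS' : op_closed S'.
  move=> i args h; rewrite inE fo; apply: hS => j.
  by have := h j; rewrite inE.
have [|m [s rs hs]] := closed_lexpow hS'.
  by apply/set0Pn; exists (g b); rewrite inE gK.
have inS z : f (reindex s z) \in S.
  have : reindex s z \in S' by apply/hs => i j e; rewrite !ffunE e.
  by rewrite inE.
pose h (z : lexpow m.+1) : sub_ostr hS := exist _ (f (reindex s z)) (inS z).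
have [ri [ro rl]] := reindex_embedding rs.
have hi : injective h by move=> z z' /(congr1 sval) /= /fi /ri.
apply/OV_finP; exists m.+1 => //; exists h; split.
  split=> //; split=> [i args|z z']; last by rewrite /= -fl -rl.
  by apply/val_inj; rewrite /= ro fo.
have /fin_all_exists[k hk] (u : sub_ostr hS) : exists z, h z = u.
  (* Such a tuple is recovered from its values on a section [p] of [s]. *)
  have /fin_all_exists[p hp] (i : 'I_m.+1) : exists j, s j = i.
    by have [j ej _] := rs i; exists j.
  pose y : {ffun 'I_n.+1 -> A} := g (sval u).
  have : y \in S' by rewrite inE gK (svalP u).
  move/hs => hy; exists [ffun i => y (p i)]; apply/val_inj => /=.
  rewrite -[RHS]gK; congr f; apply/ffunP => j; rewrite !ffunE.
  by apply: hy; rewrite hp.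
by exists k => // z; apply: hi; rewrite hk.
Qed.

(** * Joint embedding and the Ramsey property *)

(** Truncating indices at [k] is a rigid surjection, so a power embeds into every larger one. *)
Lemma OV_fin_joint (B C : ostr ar) : OV_fin op lt B -> OV_fin op lt C ->
  exists D, [/\ OV_fin op lt D, embeds B D & embeds C D].
Proof.
move=> /OV_fin_chart[n [_ [g [_ hg _ _]]]] /OV_fin_chart[m [_ [h [_ hh _ _]]]].
have clamp k : k <= maxn n m -> embeds (lexpow k.+1) (lexpow (maxn n m).+1).
  move=> le; exists (reindex (fun j : 'I_(maxn n m).+1 => inord (minn j k))).
  apply: reindex_embedding => i.
  have lt_i : i < (maxn n m).+1 by apply: leq_trans (ltn_ord i) _.
  have le_i : i <= k by rewrite -ltnS.
  exists (Ordinal lt_i) => [|t /= lt_t].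
    by apply/val_inj; rewrite /= inordK; lia.
  by rewrite inordK; lia.
exists (lexpow (maxn n m).+1); split; first exact: OV_fin_lexpow.
- by apply: embeds_trans (clamp n (leq_maxl _ _)); exists g.
- by apply: embeds_trans (clamp m (leq_maxr _ _)); exists h.
Qed.

Lemma emb_eq (B C : ostr ar) (f g : emb B C) : sval f =1 sval g -> f = g.
Proof.
case: f g => f hf [g hg] /= /functional_extensionality e.
by case: _ / e hg => hg; congr exist; exact: proof_irrelevance.
Qed.

(** Charts turn embeddings into rigid surjections and reverse composition, so [dual_ramsey]
    applies. *)
Lemma OV_fin_ramsey k (B C : ostr ar) :
  0 < k -> OV_fin op lt B -> OV_fin op lt C -> embeds B C ->
  exists D, OV_fin op lt D /\ embeds C D /\
    forall chi : emb B D -> 'I_k, exists w : emb C D, exists c : 'I_k,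
      forall f : emb B C, chi (emb_comp w f) = c.
Proof.
case: k => // k _ /OV_fin_chart[p [fB [gB [hfB hgB fBK gBK]]]].
move=> /OV_fin_chart[n [fC [gC [hfC hgC fCK gCK]]]] [f0 hf0].
have [m Hm] := dual_ramsey p n 'I_k.+1.
exists (lexpow m.+1); split; first exact: OV_fin_lexpow.
have mkE w : rigid w -> embedding (reindex w \o gC : C -> lexpow m.+1).
  by move=> rw; apply: embedding_comp => //; exact: reindex_embedding.
split.
  have [w rw _] := Hm (fun=> ord0).
  by exists (reindex w \o gC); exact: mkE.
move=> chi.
pose E (s : {ffun 'I_m.+1 -> 'I_p.+1}) (rs : embedding (reindex s)) : emb B (lexpow m.+1) :=
  exist _ (reindex s \o gB) (embedding_comp rs hgB).
(* [dual_ramsey] colours all maps, so those that give no embedding receive [ord0]; by [emb_eq] the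
   colour does not depend on the proof of being an embedding. *)
have [c hc] : exists c : {ffun 'I_m.+1 -> 'I_p.+1} -> 'I_k.+1,
    forall (s : {ffun 'I_m.+1 -> 'I_p.+1}) (rs : embedding (reindex s)), c s = chi (E s rs).
  apply: (@fin_all_exists _ (fun=> 'I_k.+1) (fun s z => forall rs, z = chi (E s rs))) => s.
  case: (classic (embedding (reindex s))) => rs.
    by exists (chi (E s rs)) => rs'; congr chi; exact: emb_eq.
  by exists ord0.
have [w rw cw] := Hm c.
pose W : emb C (lexpow m.+1) := exist _ _ (mkE w rw).
have main (f : emb B C) : exists2 s : 'I_n.+1 -> 'I_p.+1, rigid s &
    chi (emb_comp W f) = c [ffun j => s (w j)].
  have hf : embedding (gC \o (sval f \o fB)).
    by do 2!apply: embedding_comp => //; exact: svalP.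
  have [s rs es] := embedding_reindex hf; exists s => //.
  have rws : embedding (reindex [ffun j => s (w j)]).
    have -> : reindex [ffun j => s (w j)] = reindex w \o reindex s.
      by apply: functional_extensionality => x; apply/ffunP => j; rewrite !ffunE.
    by apply: embedding_comp; exact: reindex_embedding.
  rewrite (hc _ rws); congr chi; apply: emb_eq => x /=.
  have -> : gC (sval f x) = reindex s (gB x) by rewrite -es /= gBK.
  by apply/ffunP => j; rewrite !ffunE.
(* The common colour is read off the given embedding [f0]. *)
exists W, (chi (emb_comp W (exist _ f0 hf0))) => f.
by have [s rs ->] := main f; have [s0 rs0 ->] := main (exist _ f0 hf0); apply: cw.
Qed.

Lemma OV_fin_linear (B : ostr ar) : OV_fin op lt B -> linear_order (@ole _ _ B).
Proof.
move=> /OV_fin_chart[n [_ [g [_ [gi [_ gl]] _ _]]]].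
have [r [a [t tt]]] := lexpow_linear n.+1.
split; first by move=> x; rewrite gl.
split; first by move=> x y; rewrite !gl => /a /gi.
split; first by move=> y x z; rewrite !gl; exact: t.
by move=> x y; rewrite !gl.
Qed.

End Algebra.

Theorem theorem5p4 (I : Type) (ar : I -> nat) (A : finType)
  (op : forall i, ('I_(ar i) -> A) -> A) (lt : rel A) :
  primal op -> strict_linear lt ->
  ramsey_age (OV_fin op lt).
Proof.
move=> prim lin; split; first exact: OV_fin_linear.
split=> [B C /OV_finP[n n0 h] BC|].
  by apply/OV_finP; exists n => //; exact: isomorphic_trans h BC.
split; first by move=> B S hS; exact: OV_fin_sub.
split=> [B C KB KC|k B C k2].
  by have [D []] := OV_fin_joint lin KB KC; exists D.
by apply: OV_fin_ramsey => //; exact: ltnW.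
Qed.
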